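(* Let $\mathcal C$ be a (strict) braided monoidal category and let $(B_1,B_2,\mu_l,\nu_l,\mu_r,\nu_r)$ be a recursive Hopf datum in $\mathcal C$. Then $B=B_1\otimes B_2$ equipped with the structure morphisms $$\mathrm m_B=(\mathrm m_1\otimes\mathrm m_2)\circ(\mathrm{id}_1\otimes\phi_{2,1}\otimes\mathrm{id}_2),\quad\eta_B=\eta_1\otimes\eta_2,\quad\Delta_B=(\mathrm{id}_1\otimes\phi_{1,2}\otimes\mathrm{id}_2)\circ(\Delta_1\otimes\Delta_2),\quad\varepsilon_B=\varepsilon_1\otimes\varepsilon_2$$ is a bialgebra in $\mathcal C$.
   Context: $\mathcal C$ has tensor product $\otimes$, unit object $I$, braiding $\Psi$, and idempotents in $\mathcal C$ split. Algebras are unital associative, coalgebras counital coassociative, bialgebras are in the braided sense: $\Delta\circ\mathrm m=(\mathrm m\otimes\mathrm m)\circ(\mathrm{id}\otimes\Psi\otimes\mathrm{id})\circ(\Delta\otimes\Delta)$, with $\varepsilon$ an algebra morphism and $\eta$ a coalgebra morphism. Write $\mathrm{id}_j=\mathrm{id}_{B_j}$, $\Psi_{i,j}=\Psi_{B_i,B_j}$. Hopf datum. A Hopf datum $(B_1,B_2,\mu_l,\nu_l,\mu_r,\nu_r)$ consists of objects $B_1,B_2$, each an algebra $(\mathrm m_j,\eta_j)$ and a coalgebra $(\Delta_j,\varepsilon_j)$ such that $\varepsilon_j$ is an algebra morphism and $\eta_j$ is a coalgebra morphism; a left $B_2$-module structure $\mu_l:B_2\otimes B_1\to B_1$ and a left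 $B_2$-comodule structure $\nu_l:B_1\to B_2\otimes B_1$ on $B_1$; a right $B_1$-module structure $\mu_r:B_2\otimes B_1\to B_2$ and a right $B_1$-comodule structure $\nu_r:B_2\to B_2\otimes B_1$ on $B_2$. Put $\phi_{1,2}=(\mathrm m_2\otimes\mathrm m_1)\circ(\mathrm{id}_2\otimes\Psi_{1,2}\otimes\mathrm{id}_1)\circ(\nu_l\otimes\nu_r)$ and $\phi_{2,1}=(\mu_l\otimes\mu_r)\circ(\mathrm{id}_2\otimes\Psi_{2,1}\otimes\mathrm{id}_1)\circ(\Delta_2\otimes\Delta_1)$. Required identities: - $\mu_r\circ(\eta_2\otimes\mathrm{id}_1)=\eta_2\circ\varepsilon_1=(\mathrm{id}_2\otimes\varepsilon_1)\circ\nu_l$; $\varepsilon_2\circ\mu_r=\varepsilon_2\otimes\varepsilon_1=\varepsilon_1\circ\mu_l$; $\mu_l\circ(\mathrm{id}_2\otimes\eta_1)=\eta_1\circ\varepsilon_2=(\varepsilon_2\otimes\mathrm{id}_1)\circ\nu_r$; $\nu_r\circ\eta_2=\eta_2\otimes\eta_1=\nu_l\circ\eta_1$. - Algebra-coalgebra: $\Delta_1\mathrm m_1=(\mathrm m_1\otimes\mathrm m_1)\circ(\mathrm{id}_1\otimes\mu_l\otimes\mathrm{id}_1\otimes\mathrm{id}_1)\circ(\mathrm{id}_1\otimes\mathrm{id}_2\otimes\Psi_{1,1}\otimes\mathrm{id}_1)\circ(\mathrm{id}_1\otimes\nu_l\otimes\mathrm{id}_1\otimes\mathrm{id}_1)\circ(\Delta_1\otimes\Delta_1)$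 and $\Delta_2\mathrm m_2=(\mathrm m_2\otimes\mathrm m_2)\circ(\mathrm{id}_2\otimes\mathrm{id}_2\otimes\mu_r\otimes\mathrm{id}_2)\circ(\mathrm{id}_2\otimes\Psi_{2,2}\otimes\mathrm{id}_1\otimes\mathrm{id}_2)\circ(\mathrm{id}_2\otimes\mathrm{id}_2\otimes\nu_r\otimes\mathrm{id}_2)\circ(\Delta_2\otimes\Delta_2)$. - Module-comodule: $\phi_{1,2}\circ\phi_{2,1}=(\mathrm m_2\otimes\mathrm m_1)\circ(\mu_r\otimes\Psi_{1,2}\otimes\mu_l)\circ(\mathrm{id}_2\otimes\Psi_{1,1}\otimes\Psi_{2,2}\otimes\mathrm{id}_1)\circ(\nu_r\otimes\Psi_{2,1}\otimes\nu_l)\circ(\Delta_2\otimes\Delta_1)$. - Module-algebra: $\mu_r(\mathrm m_2\otimes\mathrm{id}_1)=\mathrm m_2(\mu_r\otimes\mathrm{id}_2)(\mathrm{id}_2\otimes\phi_{2,1})$; $\mu_l(\mathrm{id}_2\otimes\mathrm m_1)=\mathrm m_1(\mathrm{id}_1\otimes\mu_l)(\phi_{2,1}\otimes\mathrm{id}_1)$. - Comodule-coalgebra: $(\Delta_2\otimes\mathrm{id}_1)\nu_r=(\mathrm{id}_2\otimes\phi_{1,2})(\nu_r\otimes\mathrm{id}_2)\Delta_2$; $(\mathrm{id}_2\otimes\Delta_1)\nu_l=(\phi_{1,2}\otimes\mathrm{id}_1)(\mathrm{id}_1\otimes\nu_l)\Delta_1$. - Module-coalgebra: $\Delta_2\mu_r=(\mathrm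 m_2\otimes\mu_r)(\mu_r\otimes\Psi_{2,2}\otimes\mathrm{id}_1)(\mathrm{id}_2\otimes\Psi_{2,1}\otimes\nu_l)(\Delta_2\otimes\Delta_1)$; $\Delta_1\mu_l=(\mu_l\otimes\mathrm m_1)(\mathrm{id}_2\otimes\Psi_{1,1}\otimes\mu_l)(\nu_r\otimes\Psi_{2,1}\otimes\mathrm{id}_1)(\Delta_2\otimes\Delta_1)$. - Comodule-algebra: $\nu_r\mathrm m_2=(\mathrm m_2\otimes\mathrm m_1)(\mathrm{id}_2\otimes\Psi_{1,2}\otimes\mu_l)(\nu_r\otimes\Psi_{2,2}\otimes\mathrm{id}_1)(\Delta_2\otimes\nu_r)$; $\nu_l\mathrm m_1=(\mathrm m_2\otimes\mathrm m_1)(\mu_r\otimes\Psi_{1,2}\otimes\mathrm{id}_1)(\mathrm{id}_2\otimes\Psi_{1,1}\otimes\nu_l)(\nu_l\otimes\Delta_1)$. The map $\Phi$. For $f\in\mathrm{End}_{\mathcal C}(B_1\otimes B_2\otimes B_1\otimes B_2)$, $\Phi(f)\in\mathrm{End}_{\mathcal C}(B_1\otimes B_2\otimes B_1\otimes B_2)$ is $$\Phi(f)=(L'\otimes Q\otimes R')\circ(\mathrm{id}_1\otimes\mathrm{id}_2\otimes\Psi_{1,1}\otimes f\otimes\Psi_{2,2}\otimes\mathrm{id}_1\otimes\mathrm{id}_2)\circ(L\otimes P\otimes R),$$ where $L=(\mathrm{id}_1\otimes\nu_l)\circ\Delta_1$, $R=(\nu_r\otimes\mathrm{id}_2)\circ\Delta_2$,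 $L'=\mathrm m_1\circ(\mathrm{id}_1\otimes\mu_l)$, $R'=\mathrm m_2\circ(\mu_r\otimes\mathrm{id}_2)$, $$P=(\mu_l\otimes\mathrm{id}_1\otimes\mathrm{id}_2\otimes\mathrm{id}_1\otimes\mathrm{id}_2\otimes\mu_r)\circ(\mathrm{id}_2\otimes\Psi_{1,1}\otimes\mathrm{id}_2\otimes\mathrm{id}_1\otimes\Psi_{2,2}\otimes\mathrm{id}_1)\circ(\nu_r\otimes\Psi_{2,1}\otimes\Psi_{2,1}\otimes\nu_l)\circ(\Delta_2\otimes\Psi_{2,1}\otimes\Delta_1)\circ(\Delta_2\otimes\Delta_1)$$ is a morphism $B_2\otimes B_1\to B_1\otimes B_1\otimes B_2\otimes B_1\otimes B_2\otimes B_2$, and $$Q=(\mathrm m_2\otimes\mathrm m_1)\circ(\mathrm m_2\otimes\Psi_{1,2}\otimes\mathrm m_1)\circ(\mu_r\otimes\Psi_{1,2}\otimes\Psi_{1,2}\otimes\mu_l)\circ(\mathrm{id}_2\otimes\Psi_{1,1}\otimes\mathrm{id}_2\otimes\mathrm{id}_1\otimes\Psi_{2,2}\otimes\mathrm{id}_1)\circ(\nu_l\otimes\mathrm{id}_1\otimes\mathrm{id}_2\otimes\mathrm{id}_1\otimes\mathrm{id}_2\otimes\nu_r)$$ is a morphism $B_1\otimes B_1\otimes B_2\otimes B_1\otimes B_2\otimes B_2\to B_2\otimes B_1$. Recursive. Let $\pi=\eta_1\circ\varepsilon_1\otimes\mathrm{id}_{B_2\otimes B_1}\otimes\eta_2\circ\varepsilon_2$.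 The Hopf datum is recursive if for every endomorphism $f$ of $B_1\otimes B_2\otimes B_1\otimes B_2$ there is an integer $n\ge0$ with $\Phi^n(f)=\Phi^n(\pi\circ f\circ\pi)$. *)

(* Defs.v *)
From mathcomp Require Import all_boot.

Set Implicit Arguments.
Unset Strict Implicit.
Unset Printing Implicit Defensive.

(* A category is presented by one type of arrows with a source and a target, so
   that in a strict monoidal category the associativity of the tensor product of
   arrows is an equation between two terms of the same type, without transport
   along [(X ⊠ Y) ⊠ Z = X ⊠ (Y ⊠ Z)].
   Pitfall: [comp g f] is a total operation, but nothing is known about it
   unless [tgt f = src g]; the values on non-composable pairs are irrelevant. *)
Record category := Category {
  ob :> Type;
  mor : Type;
  src : mor -> ob;
  tgt : mor -> ob;
  idm : ob -> mor;
  comp : mor -> mor -> mor;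
  src_idm : forall X, src (idm X) = X;
  tgt_idm : forall X, tgt (idm X) = X;
  src_comp : forall g f, tgt f = src g -> src (comp g f) = src f;
  tgt_comp : forall g f, tgt f = src g -> tgt (comp g f) = tgt g;
  comp_idl : forall f, comp (idm (tgt f)) f = f;
  comp_idr : forall f, comp f (idm (src f)) = f;
  compA : forall h g f, tgt f = src g -> tgt g = src h ->
    comp h (comp g f) = comp (comp h g) f
}.

Arguments mor : clear implicits.

Notation "g ∘ f" := (comp g f) (at level 50, left associativity).
Notation "f ::: X ~> Y" := (src f = X /\ tgt f = Y)
  (at level 70, X at level 60, Y at level 60, no associativity).

Record strict_monoidal := StrictMonoidal {
  sm_cat :> category;
  unit_ob : sm_cat;
  tens_ob : sm_cat -> sm_cat -> sm_cat;
  tens : mor sm_cat -> mor sm_cat -> mor sm_cat;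
  src_tens : forall f g, src (tens f g) = tens_ob (src f) (src g);
  tgt_tens : forall f g, tgt (tens f g) = tens_ob (tgt f) (tgt g);
  tens_idm : forall X Y, tens (idm X) (idm Y) = idm (tens_ob X Y);
  tens_comp : forall g f g' f', tgt f = src g -> tgt f' = src g' ->
    tens (g ∘ f) (g' ∘ f') = tens g g' ∘ tens f f';
  tens_obA : forall X Y Z, tens_ob X (tens_ob Y Z) = tens_ob (tens_ob X Y) Z;
  tens_ob1l : forall X, tens_ob unit_ob X = X;
  tens_ob1r : forall X, tens_ob X unit_ob = X;
  tensA : forall f g h, tens f (tens g h) = tens (tens f g) h;
  tens1l : forall f, tens (idm unit_ob) f = f;
  tens1r : forall f, tens f (idm unit_ob) = f
}.

Arguments unit_ob : clear implicits.

Notation "X ⊠ Y" := (tens_ob X Y) (at level 40, left associativity).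
Notation "f ⊗ g" := (tens f g) (at level 40, left associativity).

Record strict_braided := StrictBraided {
  sb_mon :> strict_monoidal;
  braid : sb_mon -> sb_mon -> mor sb_mon;
  braid_hom : forall X Y, braid X Y ::: X ⊠ Y ~> Y ⊠ X;
  braid_iso : forall X Y, exists psi : mor sb_mon,
    [/\ psi ::: Y ⊠ X ~> X ⊠ Y,
        psi ∘ braid X Y = idm (X ⊠ Y) & braid X Y ∘ psi = idm (Y ⊠ X)];
  braid_nat : forall f g,
    braid (tgt f) (tgt g) ∘ (f ⊗ g) = (g ⊗ f) ∘ braid (src f) (src g);
  braid_tensl : forall X Y Z,
    braid (X ⊠ Y) Z = (braid X Z ⊗ idm Y) ∘ (idm X ⊗ braid Y Z);
  braid_tensr : forall X Y Z,
    braid X (Y ⊠ Z) = (idm Y ⊗ braid X Z) ∘ (braid X Y ⊗ idm Z)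
}.

Definition idempotents_split (C : category) : Prop :=
  forall (X : C) (e : mor C), e ::: X ~> X -> e ∘ e = e ->
    exists (Y : C) (p i : mor C),
      [/\ p ::: X ~> Y, i ::: Y ~> X, i ∘ p = e & p ∘ i = idm Y].

Section Structures.
Context {C : strict_braided}.
Implicit Types (A B X Y : C) (m eta Delta eps mu nu f : mor C).
Local Notation I := (unit_ob C).

Record is_algebra A m eta : Prop := IsAlgebra {
  alg_mul_hom : m ::: A ⊠ A ~> A;
  alg_unit_hom : eta ::: I ~> A;
  alg_assoc : m ∘ (m ⊗ idm A) = m ∘ (idm A ⊗ m);
  alg_unitl : m ∘ (eta ⊗ idm A) = idm A;
  alg_unitr : m ∘ (idm A ⊗ eta) = idm A
}.

Record is_coalgebra A Delta eps : Prop := IsCoalgebra {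
  coalg_comul_hom : Delta ::: A ~> A ⊠ A;
  coalg_counit_hom : eps ::: A ~> I;
  coalg_coassoc : (Delta ⊗ idm A) ∘ Delta = (idm A ⊗ Delta) ∘ Delta;
  coalg_counitl : (eps ⊗ idm A) ∘ Delta = idm A;
  coalg_counitr : (idm A ⊗ eps) ∘ Delta = idm A
}.

Definition algebra_morphism A m eta B m' eta' f : Prop :=
  [/\ f ::: A ~> B, f ∘ m = m' ∘ (f ⊗ f) & f ∘ eta = eta'].

Definition coalgebra_morphism A Delta eps B Delta' eps' f : Prop :=
  [/\ f ::: A ~> B, Delta' ∘ f = (f ⊗ f) ∘ Delta & eps' ∘ f = eps].

(* The unit object carries the algebra structure [(id_I, id_I)] and the
   coalgebra structure [(id_I, id_I)], since [I ⊠ I = I]. *)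
Definition counit_is_algebra_morphism A m eta eps : Prop :=
  algebra_morphism A m eta I (idm I) (idm I) eps.

Definition unit_is_coalgebra_morphism A Delta eps eta : Prop :=
  coalgebra_morphism I (idm I) (idm I) A Delta eps eta.

Record is_left_module A m eta X mu : Prop := IsLeftModule {
  lmod_hom : mu ::: A ⊠ X ~> X;
  lmod_assoc : mu ∘ (m ⊗ idm X) = mu ∘ (idm A ⊗ mu);
  lmod_unit : mu ∘ (eta ⊗ idm X) = idm X
}.

Record is_right_module A m eta X mu : Prop := IsRightModule {
  rmod_hom : mu ::: X ⊠ A ~> X;
  rmod_assoc : mu ∘ (mu ⊗ idm A) = mu ∘ (idm X ⊗ m);
  rmod_unit : mu ∘ (idm X ⊗ eta) = idm X
}.

Record is_left_comodule A Delta eps X nu : Prop := IsLeftComodule {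
  lcomod_hom : nu ::: X ~> A ⊠ X;
  lcomod_coassoc : (Delta ⊗ idm X) ∘ nu = (idm A ⊗ nu) ∘ nu;
  lcomod_counit : (eps ⊗ idm X) ∘ nu = idm X
}.

Record is_right_comodule A Delta eps X nu : Prop := IsRightComodule {
  rcomod_hom : nu ::: X ~> X ⊠ A;
  rcomod_coassoc : (nu ⊗ idm A) ∘ nu = (idm X ⊗ Delta) ∘ nu;
  rcomod_counit : (idm X ⊗ eps) ∘ nu = idm X
}.

Record is_bialgebra B m eta Delta eps : Prop := IsBialgebra {
  bialg_algebra : is_algebra B m eta;
  bialg_coalgebra : is_coalgebra B Delta eps;
  bialg_comul_mul :
    Delta ∘ m = (m ⊗ m) ∘ (idm B ⊗ braid B B ⊗ idm B) ∘ (Delta ⊗ Delta);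
  bialg_counit : counit_is_algebra_morphism B m eta eps;
  bialg_unit : unit_is_coalgebra_morphism B Delta eps eta
}.

End Structures.

Record hopf_predatum (C : strict_braided) := HopfPredatum {
  B1 : C;
  B2 : C;
  m1 : mor C;
  eta1 : mor C;
  Delta1 : mor C;
  eps1 : mor C;
  m2 : mor C;
  eta2 : mor C;
  Delta2 : mor C;
  eps2 : mor C;
  mu_l : mor C;
  nu_l : mor C;
  mu_r : mor C;
  nu_r : mor C
}.

Section HopfDatum.
Context {C : strict_braided} (D : hopf_predatum C).

Local Notation B1 := (B1 D).
Local Notation B2 := (B2 D).
Local Notation m1 := (m1 D).
Local Notation eta1 := (eta1 D).
Local Notation Delta1 := (Delta1 D).
Local Notation eps1 := (eps1 D).
Local Notation m2 := (m2 D).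
Local Notation eta2 := (eta2 D).
Local Notation Delta2 := (Delta2 D).
Local Notation eps2 := (eps2 D).
Local Notation mu_l := (mu_l D).
Local Notation nu_l := (nu_l D).
Local Notation mu_r := (mu_r D).
Local Notation nu_r := (nu_r D).
Local Notation id1 := (idm B1).
Local Notation id2 := (idm B2).
Local Notation Psi11 := (braid B1 B1).
Local Notation Psi12 := (braid B1 B2).
Local Notation Psi21 := (braid B2 B1).
Local Notation Psi22 := (braid B2 B2).

Definition phi12 : mor C :=
  (m2 ⊗ m1) ∘ (id2 ⊗ Psi12 ⊗ id1) ∘ (nu_l ⊗ nu_r).

Definition phi21 : mor C :=
  (mu_l ⊗ mu_r) ∘ (id2 ⊗ Psi21 ⊗ id1) ∘ (Delta2 ⊗ Delta1).

Record is_hopf_datum : Prop := IsHopfDatum {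
  hd_alg1 : is_algebra B1 m1 eta1;
  hd_coalg1 : is_coalgebra B1 Delta1 eps1;
  hd_counit1 : counit_is_algebra_morphism B1 m1 eta1 eps1;
  hd_unit1 : unit_is_coalgebra_morphism B1 Delta1 eps1 eta1;
  hd_alg2 : is_algebra B2 m2 eta2;
  hd_coalg2 : is_coalgebra B2 Delta2 eps2;
  hd_counit2 : counit_is_algebra_morphism B2 m2 eta2 eps2;
  hd_unit2 : unit_is_coalgebra_morphism B2 Delta2 eps2 eta2;
  hd_lmod : is_left_module B2 m2 eta2 B1 mu_l;
  hd_lcomod : is_left_comodule B2 Delta2 eps2 B1 nu_l;
  hd_rmod : is_right_module B1 m1 eta1 B2 mu_r;
  hd_rcomod : is_right_comodule B1 Delta1 eps1 B2 nu_r;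
  hd_mur_unit : mu_r ∘ (eta2 ⊗ id1) = eta2 ∘ eps1;
  hd_nul_counit : (id2 ⊗ eps1) ∘ nu_l = eta2 ∘ eps1;
  hd_mur_counit : eps2 ∘ mu_r = eps2 ⊗ eps1;
  hd_mul_counit : eps1 ∘ mu_l = eps2 ⊗ eps1;
  hd_mul_unit : mu_l ∘ (id2 ⊗ eta1) = eta1 ∘ eps2;
  hd_nur_counit : (eps2 ⊗ id1) ∘ nu_r = eta1 ∘ eps2;
  hd_nur_unit : nu_r ∘ eta2 = eta2 ⊗ eta1;
  hd_nul_unit : nu_l ∘ eta1 = eta2 ⊗ eta1;
  hd_alg_coalg1 :
    Delta1 ∘ m1 =
    (m1 ⊗ m1) ∘ (id1 ⊗ mu_l ⊗ id1 ⊗ id1) ∘ (id1 ⊗ id2 ⊗ Psi11 ⊗ id1)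
    ∘ (id1 ⊗ nu_l ⊗ id1 ⊗ id1) ∘ (Delta1 ⊗ Delta1);
  hd_alg_coalg2 :
    Delta2 ∘ m2 =
    (m2 ⊗ m2) ∘ (id2 ⊗ id2 ⊗ mu_r ⊗ id2) ∘ (id2 ⊗ Psi22 ⊗ id1 ⊗ id2)
    ∘ (id2 ⊗ id2 ⊗ nu_r ⊗ id2) ∘ (Delta2 ⊗ Delta2);
  hd_mod_comod :
    phi12 ∘ phi21 =
    (m2 ⊗ m1) ∘ (mu_r ⊗ Psi12 ⊗ mu_l) ∘ (id2 ⊗ Psi11 ⊗ Psi22 ⊗ id1)
    ∘ (nu_r ⊗ Psi21 ⊗ nu_l) ∘ (Delta2 ⊗ Delta1);
  hd_mod_algr :
    mu_r ∘ (m2 ⊗ id1) = m2 ∘ (mu_r ⊗ id2) ∘ (id2 ⊗ phi21);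
  hd_mod_algl :
    mu_l ∘ (id2 ⊗ m1) = m1 ∘ (id1 ⊗ mu_l) ∘ (phi21 ⊗ id1);
  hd_comod_coalgr :
    (Delta2 ⊗ id1) ∘ nu_r = (id2 ⊗ phi12) ∘ (nu_r ⊗ id2) ∘ Delta2;
  hd_comod_coalgl :
    (id2 ⊗ Delta1) ∘ nu_l = (phi12 ⊗ id1) ∘ (id1 ⊗ nu_l) ∘ Delta1;
  hd_mod_coalgr :
    Delta2 ∘ mu_r =
    (m2 ⊗ mu_r) ∘ (mu_r ⊗ Psi22 ⊗ id1) ∘ (id2 ⊗ Psi21 ⊗ nu_l)
    ∘ (Delta2 ⊗ Delta1);
  hd_mod_coalgl :
    Delta1 ∘ mu_l =
    (mu_l ⊗ m1) ∘ (id2 ⊗ Psi11 ⊗ mu_l) ∘ (nu_r ⊗ Psi21 ⊗ id1)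
    ∘ (Delta2 ⊗ Delta1);
  hd_comod_algr :
    nu_r ∘ m2 =
    (m2 ⊗ m1) ∘ (id2 ⊗ Psi12 ⊗ mu_l) ∘ (nu_r ⊗ Psi22 ⊗ id1)
    ∘ (Delta2 ⊗ nu_r);
  hd_comod_algl :
    nu_l ∘ m1 =
    (m2 ⊗ m1) ∘ (mu_r ⊗ Psi12 ⊗ id1) ∘ (id2 ⊗ Psi11 ⊗ nu_l)
    ∘ (nu_l ⊗ Delta1)
}.

Definition PhiL : mor C := (id1 ⊗ nu_l) ∘ Delta1.
Definition PhiR : mor C := (nu_r ⊗ id2) ∘ Delta2.
Definition PhiL' : mor C := m1 ∘ (id1 ⊗ mu_l).
Definition PhiR' : mor C := m2 ∘ (mu_r ⊗ id2).

Definition PhiP : mor C :=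
  (mu_l ⊗ id1 ⊗ id2 ⊗ id1 ⊗ id2 ⊗ mu_r)
  ∘ (id2 ⊗ Psi11 ⊗ id2 ⊗ id1 ⊗ Psi22 ⊗ id1)
  ∘ (nu_r ⊗ Psi21 ⊗ Psi21 ⊗ nu_l)
  ∘ (Delta2 ⊗ Psi21 ⊗ Delta1)
  ∘ (Delta2 ⊗ Delta1).

Definition PhiQ : mor C :=
  (m2 ⊗ m1)
  ∘ (m2 ⊗ Psi12 ⊗ m1)
  ∘ (mu_r ⊗ Psi12 ⊗ Psi12 ⊗ mu_l)
  ∘ (id2 ⊗ Psi11 ⊗ id2 ⊗ id1 ⊗ Psi22 ⊗ id1)
  ∘ (nu_l ⊗ id1 ⊗ id2 ⊗ id1 ⊗ id2 ⊗ nu_r).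

Definition Phi (f : mor C) : mor C :=
  (PhiL' ⊗ PhiQ ⊗ PhiR')
  ∘ (id1 ⊗ id2 ⊗ Psi11 ⊗ f ⊗ Psi22 ⊗ id1 ⊗ id2)
  ∘ (PhiL ⊗ PhiP ⊗ PhiR).

Definition pi_unit : mor C :=
  (eta1 ∘ eps1) ⊗ idm (B2 ⊠ B1) ⊗ (eta2 ∘ eps2).

Definition recursive : Prop :=
  forall f : mor C, f ::: B1 ⊠ B2 ⊠ B1 ⊠ B2 ~> B1 ⊠ B2 ⊠ B1 ⊠ B2 ->
    exists n : nat, iter n Phi f = iter n Phi (pi_unit ∘ f ∘ pi_unit).

Definition mB : mor C := (m1 ⊗ m2) ∘ (id1 ⊗ phi21 ⊗ id2).
Definition etaB : mor C := eta1 ⊗ eta2.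
Definition DeltaB : mor C := (id1 ⊗ phi12 ⊗ id2) ∘ (Delta1 ⊗ Delta2).
Definition epsB : mor C := eps1 ⊗ eps2.

End HopfDatum.

Lemma hom_idm (C : category) (X : C) : idm X ::: X ~> X.
Proof. by rewrite src_idm tgt_idm. Qed.

Lemma hom_comp (C : category) (g f : mor C) (X Y Y' Z : C) :
  g ::: Y' ~> Z -> f ::: X ~> Y -> Y = Y' -> g ∘ f ::: X ~> Z.
Proof.
move=> [sg tg] [sf tf] eY; have fg : tgt f = src g by rewrite tf sg.
by rewrite src_comp // tgt_comp.
Qed.

Lemma hom_tens (C : strict_monoidal) (f g : mor C) (X Y X' Y' : C) :
  f ::: X ~> Y -> g ::: X' ~> Y' -> f ⊗ g ::: X ⊠ X' ~> Y ⊠ Y'.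
Proof. by move=> [<- <-] [<- <-]; rewrite src_tens tgt_tens. Qed.

Lemma hom_eq (C : category) (f : mor C) (X X' Y Y' : C) :
  f ::: X ~> Y -> X = X' -> Y = Y' -> f ::: X' ~> Y'.
Proof. by move=> fXY <- <-. Qed.

Ltac hom_step :=
  match goal with
  | h : src ?f = _ /\ _ |- src ?f = _ /\ _ => exact: h
  | |- src (idm _) = _ /\ _ => exact: hom_idm
  | |- src (braid _ _) = _ /\ _ => exact: braid_hom
  | |- src (_ ∘ _) = _ /\ _ => eapply hom_comp
  | |- src (_ ⊗ _) = _ /\ _ => eapply hom_tens
  | |- @eq (ob _) _ _ => rewrite ?tens_obA ?tens_ob1l ?tens_ob1r; reflexivity
  end.

Ltac hom_tac := eapply hom_eq; repeat hom_step.

(* The morphisms defined above have the intended sources and targets, so that no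
   junk value of [comp] enters them. *)
Section Typing.
Context {C : strict_braided} {D : hopf_predatum C} (HD : is_hopf_datum D).

Local Notation B1 := (B1 D).
Local Notation B2 := (B2 D).

Lemma structure_homs :
  [/\ m1 D ::: B1 ⊠ B1 ~> B1, eta1 D ::: unit_ob C ~> B1,
      Delta1 D ::: B1 ~> B1 ⊠ B1 & eps1 D ::: B1 ~> unit_ob C] /\
  [/\ m2 D ::: B2 ⊠ B2 ~> B2, eta2 D ::: unit_ob C ~> B2,
      Delta2 D ::: B2 ~> B2 ⊠ B2 & eps2 D ::: B2 ~> unit_ob C] /\
  [/\ mu_l D ::: B2 ⊠ B1 ~> B1, nu_l D ::: B1 ~> B2 ⊠ B1,
      mu_r D ::: B2 ⊠ B1 ~> B2 & nu_r D ::: B2 ~> B2 ⊠ B1].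
Proof.
by case: HD => [[? ? _ _ _] [? ? _ _ _] _ _ [? ? _ _ _] [? ? _ _ _] _ _
  [? _ _] [? _ _] [? _ _] [? _ _]] *.
Qed.

Local Ltac unpack :=
  case: structure_homs => [[? ? ? ?] [[? ? ? ?] [? ? ? ?]]].

Lemma phi12_hom : phi12 D ::: B1 ⊠ B2 ~> B2 ⊠ B1.
Proof. by unpack; rewrite /phi12; hom_tac. Qed.

Lemma phi21_hom : phi21 D ::: B2 ⊠ B1 ~> B1 ⊠ B2.
Proof. by unpack; rewrite /phi21; hom_tac. Qed.

Lemma PhiP_hom : PhiP D ::: B2 ⊠ B1 ~> B1 ⊠ B1 ⊠ B2 ⊠ B1 ⊠ B2 ⊠ B2.
Proof. by unpack; rewrite /PhiP; hom_tac. Qed.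

Lemma PhiQ_hom : PhiQ D ::: B1 ⊠ B1 ⊠ B2 ⊠ B1 ⊠ B2 ⊠ B2 ~> B2 ⊠ B1.
Proof. by unpack; rewrite /PhiQ; hom_tac. Qed.

Lemma Phi_hom f : f ::: B1 ⊠ B2 ⊠ B1 ⊠ B2 ~> B1 ⊠ B2 ⊠ B1 ⊠ B2 ->
  Phi D f ::: B1 ⊠ B2 ⊠ B1 ⊠ B2 ~> B1 ⊠ B2 ⊠ B1 ⊠ B2.
Proof.
move=> fH; have PH := PhiP_hom; have QH := PhiQ_hom.
by unpack; rewrite /Phi /PhiL /PhiR /PhiL' /PhiR'; hom_tac.
Qed.

Lemma pi_unit_hom : pi_unit D ::: B1 ⊠ B2 ⊠ B1 ⊠ B2 ~> B1 ⊠ B2 ⊠ B1 ⊠ B2.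
Proof. by unpack; rewrite /pi_unit; hom_tac. Qed.

Lemma mB_hom : mB D ::: (B1 ⊠ B2) ⊠ (B1 ⊠ B2) ~> B1 ⊠ B2.
Proof. by have H := phi21_hom; unpack; rewrite /mB; hom_tac. Qed.

Lemma etaB_hom : etaB D ::: unit_ob C ~> B1 ⊠ B2.
Proof. by unpack; rewrite /etaB; hom_tac. Qed.

Lemma DeltaB_hom : DeltaB D ::: B1 ⊠ B2 ~> (B1 ⊠ B2) ⊠ (B1 ⊠ B2).
Proof. by have H := phi12_hom; unpack; rewrite /DeltaB; hom_tac. Qed.

Lemma epsB_hom : epsB D ::: B1 ⊠ B2 ~> unit_ob C.
Proof. by unpack; rewrite /epsB; hom_tac. Qed.

End Typing.

(* Main.v *)
From Stdlib Require List.
From HB Require Import structures.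
From mathcomp Require Import all_boot.
Require Import Defs.

Set Implicit Arguments.
Unset Strict Implicit.
Unset Printing Implicit Defensive.

(** Let [f1 = Δ_B ∘ m_B] and [f2 = (m_B ⊗ m_B) ∘ (id ⊗ Ψ ⊗ id) ∘ (Δ_B ⊗ Δ_B)].
    Both are fixed points of [Φ], and [π ∘ f1 ∘ π = π ∘ f2 ∘ π] because the
    restrictions of [f1] and [f2] to [B2 ⊗ B1], corestricted to [B2 ⊗ B1], are
    the two sides of the module-comodule axiom. By recursivity
    [f1 = Φ^n (π f1 π) = Φ^n (π f2 π) = f2] for [n] large.
    That [f1] is fixed comes from [(Δ1 ⊗ Δ2) ∘ φ21 = (id ⊗ m_B ⊗ id) ∘ P] and
    its dual; that [f2] is fixed, from the analogue of the first identity for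
    the restriction [g] of [f2] to [B2 ⊗ B1], namely
    [(Δ1 ⊗ id ⊗ id ⊗ Δ2) ∘ g = (id ⊗ f2 ⊗ id) ∘ P].
    These identities, like associativity and coassociativity, hold because both
    sides have the same normal form as string diagrams when the axioms are
    oriented so as to move coproducts and coactions before braidings, and
    braidings before actions and products. *)

(** * Composition and interchange of typed morphisms *)

Section Category.
Context {C : category}.
Implicit Types f g h : mor C.

Lemma comp_idmL f X Y : f ::: X ~> Y -> idm Y ∘ f = f.
Proof. by case=> _ <-; exact: comp_idl. Qed.

Lemma comp_idmR f X Y : f ::: X ~> Y -> f ∘ idm X = f.
Proof. by case=> <- _; exact: comp_idr. Qed.

Lemma comp_assoc h g f X Y Z W :
  f ::: X ~> Y -> g ::: Y ~> Z -> h ::: Z ~> W -> h ∘ g ∘ f = h ∘ (g ∘ f).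
Proof. by move=> [_ tf] [sg tg] [sh _]; rewrite compA // ?tf ?tg. Qed.

End Category.

Section Monoidal.
Context {C : strict_monoidal}.
Implicit Types f g : mor C.

Lemma tens_comp_hom g f g' f' X Y Z X' Y' Z' :
  f ::: X ~> Y -> g ::: Y ~> Z -> f' ::: X' ~> Y' -> g' ::: Y' ~> Z' ->
  (g ⊗ g') ∘ (f ⊗ f') = (g ∘ f) ⊗ (g' ∘ f').
Proof. by move=> [_ tf] [sg _] [_ tf'] [sg' _]; rewrite tens_comp ?tf ?tf'. Qed.

Lemma tens_top f g X Y X' Y' : f ::: X ~> Y -> g ::: X' ~> Y' ->
  (idm Y ⊗ g) ∘ (f ⊗ idm X') = f ⊗ g.
Proof.
move=> fH gH; rewrite (tens_comp_hom fH (hom_idm _) (hom_idm _) gH).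
by rewrite (comp_idmL fH) (comp_idmR gH).
Qed.

Lemma tens_bot f g X Y X' Y' : f ::: X ~> Y -> g ::: X' ~> Y' ->
  (f ⊗ idm Y') ∘ (idm X ⊗ g) = f ⊗ g.
Proof.
move=> fH gH; rewrite (tens_comp_hom (hom_idm _) fH gH (hom_idm _)).
by rewrite (comp_idmL gH) (comp_idmR fH).
Qed.

End Monoidal.

(** A hexagon identity with two unit objects makes this braiding idempotent, and an invertible
    idempotent is an identity. *)
Lemma braid_unitl (C : strict_braided) (X : C) :
  braid (unit_ob C) X = idm X.
Proof.
have H := braid_hom (unit_ob C) X; rewrite tens_ob1l tens_ob1r in H.
have [p []] := braid_iso (unit_ob C) X; rewrite tens_ob1l tens_ob1r => pH pb _.
have e := braid_tensl (unit_ob C) (unit_ob C) X.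
rewrite tens_ob1l tens1l tens1r in e.
by rewrite -{1}(comp_idmL H) -pb (comp_assoc H H pH) -e pb.
Qed.

Lemma braid_unitr (C : strict_braided) (X : C) :
  braid X (unit_ob C) = idm X.
Proof.
have H := braid_hom X (unit_ob C); rewrite tens_ob1l tens_ob1r in H.
have [p []] := braid_iso X (unit_ob C); rewrite tens_ob1l tens_ob1r => pH pb _.
have e := braid_tensr X (unit_ob C) (unit_ob C).
rewrite tens_ob1l tens1l tens1r in e.
by rewrite -{1}(comp_idmL H) -pb (comp_assoc H H pH) -e pb.
Qed.

(** In [swap_sound] this produces the wires that lie between two independent layers. *)
Lemma cat_prefix (T : eqType) (a b c d : seq T) : a ++ b = c ++ d ->
  size c <= size a -> exists r, a = c ++ r /\ d = r ++ b.
Proof.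
move=> e le_ca; have ec : take (size c) a = c.
  by rewrite -(takel_cat b le_ca) e take_size_cat.
have ea := cat_take_drop (size c) a; rewrite ec in ea.
exists (drop (size c) a); split=> //.
by move/eqP: e; rewrite -{1}ea -catA eqseq_cat // eqxx => /eqP.
Qed.

(** * String diagrams *)

(* [true] stands for [B1] and [false] for [B2]. *)
Notation wire := bool.

Inductive gen : Type :=
| Mul of wire | Unit of wire | Comul of wire | Counit of wire
| ActL | ActR | CoactL | CoactR
| Cross of wire & wire.

Scheme Equality for gen.

Lemma gen_beqP : Equality.axiom gen_beq.
Proof.
move=> x y; apply: (iffP idP); first exact: internal_gen_dec_bl.
exact: internal_gen_dec_lb.
Qed.

HB.instance Definition _ := hasDecEq.Build gen gen_beqP.

Definition gdom (g : gen) : seq wire :=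
  match g with
  | Mul i => [:: i; i] | Unit _ => [::] | Comul i => [:: i]
  | Counit i => [:: i] | ActL | ActR => [:: false; true]
  | CoactL => [:: true] | CoactR => [:: false] | Cross i j => [:: i; j]
  end.

Definition gcod (g : gen) : seq wire :=
  match g with
  | Mul i => [:: i] | Unit i => [:: i] | Comul i => [:: i; i]
  | Counit _ => [::] | ActL => [:: true] | ActR => [:: false]
  | CoactL | CoactR => [:: false; true] | Cross i j => [:: j; i]
  end.

(* A layer [(o, g)] applies [g] to consecutive wires, leaving [o] wires on its
   left; a word is a list of layers, the first being applied first. *)
Notation layer := (nat * gen)%type.
Notation word := (seq (nat * gen)).

Definition step (s : seq wire) (l : layer) : seq wire :=
  take l.1 s ++ gcod l.2 ++ drop (l.1 + size (gdom l.2)) s.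

Definition fits (s : seq wire) (l : layer) : bool :=
  (l.1 <= size s) && (take (size (gdom l.2)) (drop l.1 s) == gdom l.2).

Fixpoint typed (s : seq wire) (w : word) : bool :=
  if w is l :: w' then fits s l && typed (step s l) w' else true.

Definition out (s : seq wire) (w : word) : seq wire := foldl step s w.

Definition shift (n : nat) (w : word) : word := [seq (n + l.1, l.2) | l <- w].

Lemma fitsP s l :
  reflect (exists p q, s = p ++ gdom l.2 ++ q /\ l.1 = size p) (fits s l).
Proof.
apply: (iffP andP) => [[le_ls /eqP e]|[p [q [-> ->]]]].
  exists (take l.1 s), (drop (size (gdom l.2)) (drop l.1 s)); split.
    by rewrite -{1}e !cat_take_drop.
  by rewrite size_takel.
by rewrite size_cat leq_addr drop_size_cat // take_size_cat.
Qed.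

Lemma step_cat p q g : step (p ++ gdom g ++ q) (size p, g) = p ++ gcod g ++ q.
Proof.
by rewrite /step /= take_size_cat // addnC -drop_drop !drop_size_cat.
Qed.

Lemma fits_cat p q g : fits (p ++ gdom g ++ q) (size p, g).
Proof. by apply/fitsP; exists p, q. Qed.

Lemma typed_cat s v w : typed s (v ++ w) = typed s v && typed (out s v) w.
Proof. by elim: v s => //= l v IHv s; rewrite IHv andbA. Qed.

Lemma out_cat s v w : out s (v ++ w) = out (out s v) w.
Proof. exact: foldl_cat. Qed.

(* [l] followed by [l'] is the same as [l'] followed by [l]; both layers are
   re-indexed because the one on the left may change the number of wires. *)
Definition swap (l l' : layer) : option (layer * layer) :=
  let: (o, g) := l in let: (o', g') := l' in
  if o' + size (gdom g') <= o then
    Some ((o', g'), (o - size (gdom g') + size (gcod g'), g))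
  else if o + size (gcod g) <= o' then
    Some ((o' - size (gcod g) + size (gdom g), g'), (o, g))
  else None.

(* Moves the layer [x] that follows [w] in front of [w]. *)
Fixpoint slide (w : word) (x : layer) : option (layer * word) :=
  if w is y :: w' then
    if slide w' x is Some (x1, w1) then
      if swap y x1 is Some (x2, y2) then Some (x2, y2 :: w1) else None
    else None
  else Some (x, [::]).

(* The offset at which the block [b] is an instance of the pattern [p]; it is
   meaningless, but harmless, if [b] is not an instance of [p]. *)
Definition offset (p b : word) : nat :=
  if (p, b) is (x :: _, y :: _) then y.1 - x.1 else 0.

(* [rest] is scanned for the layers that complete [blk] to an instance of the
   pattern [p]. The layers independent of [blk] go to [pre], those which depend
   on it to [aft]. *)
Fixpoint gather (p pre blk aft rest : word) : option (word * word * word) :=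
  if size blk == size p then Some (pre, blk, aft ++ rest)
  else if rest is x :: rest' then
    if slide aft x is Some (x1, aft1) then
      if x1 == nth x1 (shift (offset p blk) p) (size blk) then
        gather p pre (rcons blk x1) aft1 rest'
      else if slide blk x1 is Some (x2, blk2) then
        gather p (rcons pre x2) blk2 aft1 rest'
      else gather p pre blk (rcons aft x) rest'
    else gather p pre blk (rcons aft x) rest'
  else None.

Record wrule := WRule { wdom : seq wire; wlhs : word; wrhs : word }.

(** What [gather] returns is compared with the pattern once more, and the wires with [wdom r].
    Soundness thus only needs that [gather] interchanges independent layers. *)
Definition rewrite_at (r : wrule) (s : seq wire) (w : word) (i : nat) :
    option word :=
  if (drop i w, wlhs r) is (x :: rest, y :: _) then
    if x.2 == y.2 then
      if gather (wlhs r) (take i w) [:: x] [::] rest is Some (pre, blk, post)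
      then
        let n := offset (wlhs r) blk in
        let u := out s pre in
        if [&& blk == shift n (wlhs r), n <= size u
             & take (size (wdom r)) (drop n u) == wdom r]
        then Some (pre ++ shift n (wrhs r) ++ post) else None
      else None
    else None
  else None.

(* A trace lists rewriting steps as pairs (rule number, position of the first
   layer). Only [replay] is proved sound: traces are found by [search], whose
   cost is thus kept out of the proof terms. *)
Fixpoint replay (rs : seq wrule) (s : seq wire) (tr : seq (nat * nat))
    (w : word) : word :=
  if tr is (k, i) :: tr' then
    if drop k rs is r :: _ then
      if rewrite_at r s w i is Some w' then replay rs s tr' w' else w
    else w
  else w.

(* Conditionals instead of [&&] and [||], both arguments of which would always
   be computed by [vm_compute]. *)
Fixpoint pull (x : layer) (k : word -> bool) (aft rest : word) : bool :=
  if rest is y :: rest' then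
    if (if slide aft y is Some (y1, aft1) then
          if y1 == x then k (aft1 ++ rest') else false
        else false)
    then true else pull x k (rcons aft y) rest'
  else false.

(* Equality of words up to interchange. All the candidates for the next layer
   are tried, since layers without inputs can be ambiguous. *)
Fixpoint same (v w : word) {struct w} : bool :=
  if w is x :: w' then pull x (fun v' => same v' w') [::] v else nilp v.

(** * Expressions for morphisms and their compilation to words *)

Inductive expr : Type :=
| Id of seq wire
| Gen of gen
| Braid of seq wire & seq wire
| Comp of expr & expr
| Tens of expr & expr.

Fixpoint edom (e : expr) : seq wire :=
  match e with
  | Id s => s | Gen g => gdom g | Braid s t => s ++ t
  | Comp _ f => edom f | Tens f g => edom f ++ edom g
  end.

Fixpoint ecod (e : expr) : seq wire :=
  match e with
  | Id s => s | Gen g => gcod g | Braid s t => t ++ s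
  | Comp g _ => ecod g | Tens f g => ecod f ++ ecod g
  end.

Fixpoint wf (e : expr) : bool :=
  match e with
  | Id _ | Gen _ | Braid _ _ => true
  | Comp g f => [&& wf g, wf f & ecod f == edom g]
  | Tens f g => wf f && wf g
  end.

(** This recursion and that of [cross] follow the two hexagon identities. *)
Fixpoint cross1 (i : wire) (t : seq wire) : word :=
  if t is j :: t' then (0, Cross i j) :: shift 1 (cross1 i t') else [::].

Fixpoint cross (s t : seq wire) : word :=
  if s is i :: s' then shift 1 (cross s' t) ++ cross1 i t else [::].

(** In a tensor product [f] is run before [g], so the wires to the left of [g] are already those of
    the codomain of [f]. *)
Fixpoint compile (e : expr) : word :=
  match e with
  | Id _ => [::]
  | Gen g => [:: (0, g)]
  | Braid s t => cross s t
  | Comp g f => compile f ++ compile g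
  | Tens f g => compile f ++ shift (size (ecod f)) (compile g)
  end.

Notation rule := (expr * expr)%type.

Definition rule_wf (r : rule) : bool :=
  [&& wf r.1, wf r.2, edom r.1 == edom r.2 & ecod r.1 == ecod r.2].

Definition compile_rule (r : rule) : wrule :=
  WRule (edom r.1) (compile r.1) (compile r.2).

Definition check (rs : seq rule) (e e' : expr) (tr tr' : seq (nat * nat)) :=
  let ws := map compile_rule rs in
  [&& all rule_wf rs, rule_wf (e, e')
    & same (replay ws (edom e) tr (compile e))
           (replay ws (edom e) tr' (compile e'))].

Fixpoint find_step (rs : seq wrule) (k : nat) (s : seq wire) (w : word) :
    option (nat * nat * word) :=
  if rs is r :: rs' then
    let fix find_pos i n :=
      if n is n'.+1 then
        if rewrite_at r s w i is Some w' then Some (k, i, w')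
        else find_pos i.+1 n'
      else None in
    if find_pos 0 (size w) is Some x then Some x else find_step rs' k.+1 s w
  else None.

Fixpoint search (fuel : nat) (rs : seq wrule) (s : seq wire) (w : word) :
    seq (nat * nat) :=
  if fuel is n.+1 then
    if find_step rs 0 s w is Some (ki, w') then ki :: search n rs s w'
    else [::]
  else [::].

(** * Soundness of diagram rewriting *)

Section Semantics.
Context {C : strict_braided} (D : hopf_predatum C) (HD : is_hopf_datum D).

Definition wire_ob (i : wire) : C := if i then B1 D else B2 D.

(* Associated to the left, so that [den] of a reified morphism is convertible to
   this morphism. *)
Definition obs (s : seq wire) : C :=
  if s is i :: s' then foldl (fun X j => X ⊠ wire_ob j) (wire_ob i) s'
  else unit_ob C.

Definition gmor (g : gen) : mor C :=
  match g with
  | Mul i => if i then m1 D else m2 D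
  | Unit i => if i then eta1 D else eta2 D
  | Comul i => if i then Delta1 D else Delta2 D
  | Counit i => if i then eps1 D else eps2 D
  | ActL => mu_l D | ActR => mu_r D | CoactL => nu_l D | CoactR => nu_r D
  | Cross i j => braid (wire_ob i) (wire_ob j)
  end.

Fixpoint den (e : expr) : mor C :=
  match e with
  | Id s => idm (obs s)
  | Gen g => gmor g
  | Braid s t => braid (obs s) (obs t)
  | Comp g f => den g ∘ den f
  | Tens f g => den f ⊗ den g
  end.

Definition lden (s : seq wire) (l : layer) : mor C :=
  idm (obs (take l.1 s)) ⊗ gmor l.2
  ⊗ idm (obs (drop (l.1 + size (gdom l.2)) s)).

Fixpoint wden (s : seq wire) (w : word) : mor C :=
  if w is l :: w' then wden (step s l) w' ∘ lden s l else idm (obs s).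

Lemma obs_cat s t : obs (s ++ t) = obs s ⊠ obs t.
Proof.
have E X Y u : foldl (fun X j => X ⊠ wire_ob j) (X ⊠ Y) u =
    X ⊠ foldl (fun X j => X ⊠ wire_ob j) Y u.
  by elim: u Y => //= j u IHu Y; rewrite -tens_obA IHu.
case: s => [|i s]; first by rewrite /= tens_ob1l.
case: t => [|j t]; first by rewrite cats0 /= tens_ob1r.
by rewrite /= foldl_cat /= E.
Qed.

Lemma gmor_hom g : gmor g ::: obs (gdom g) ~> obs (gcod g).
Proof.
have [[? ? ? ?] [[? ? ? ?] [? ? ? ?]]] := structure_homs HD.
by case: g => [[]|[]|[]|[]|||||i j] //=; exact: braid_hom.
Qed.

Lemma lden_cat p q g :
  lden (p ++ gdom g ++ q) (size p, g) = idm (obs p) ⊗ gmor g ⊗ idm (obs q).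
Proof.
by rewrite /lden /= take_size_cat // addnC -drop_drop !drop_size_cat.
Qed.

Lemma lden_hom s l : fits s l -> lden s l ::: obs s ~> obs (step s l).
Proof.
case: l => o g /fitsP[p [q /= [-> ->]]]; rewrite lden_cat step_cat !obs_cat.
rewrite !tens_obA.
exact: hom_tens (hom_tens (hom_idm _) (gmor_hom g)) (hom_idm _).
Qed.

Lemma wden_hom s w : typed s w -> wden s w ::: obs s ~> obs (out s w).
Proof.
elim: w s => [|l w IHw] s /=; first by move=> _; exact: hom_idm.
by case/andP=> fl /IHw H; apply: hom_comp H (lden_hom fl) _.
Qed.

Lemma wden_wcat s v w : typed s (v ++ w) ->
  wden s (v ++ w) = wden (out s v) w ∘ wden s v.
Proof.
rewrite typed_cat; elim: v s => [|l v IHv] s /=.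
  by move=> tw; rewrite (comp_idmR (wden_hom tw)).
case/andP=> /andP[fl tv] tw; rewrite IHv ?tv //.
by rewrite (comp_assoc (lden_hom fl) (wden_hom tv) (wden_hom tw)).
Qed.

Lemma shift_sound p q s w : typed s w ->
  [/\ typed (p ++ s ++ q) (shift (size p) w),
      out (p ++ s ++ q) (shift (size p) w) = p ++ out s w ++ q
    & wden (p ++ s ++ q) (shift (size p) w) =
      idm (obs p) ⊗ wden s w ⊗ idm (obs q)].
Proof.
elim: w s => [|[o g] w IHw] s /=; first by rewrite !tens_idm !obs_cat !tens_obA.
case/andP=> /fitsP[a [b /= [-> ->]]]; rewrite step_cat => tw.
have [IH1 IH2 IH3] := IHw _ tw.
have E : p ++ (a ++ gdom g ++ b) ++ q = (p ++ a) ++ gdom g ++ (b ++ q).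
  by rewrite !catA.
have E' : (p ++ a) ++ gcod g ++ (b ++ q) = p ++ (a ++ gcod g ++ b) ++ q.
  by rewrite !catA.
rewrite E -size_cat step_cat fits_cat E' /= IH1 IH2 IH3; split=> //.
rewrite !lden_cat !obs_cat.
have lH : idm (obs a) ⊗ gmor g ⊗ idm (obs b) ::: obs (a ++ gdom g ++ b) ~>
    obs (a ++ gcod g ++ b).
  by rewrite -(lden_cat a b g) -(step_cat a b g); apply/lden_hom/fits_cat.
have wH := wden_hom tw; have I (X : C) := hom_idm X.
set F := idm (obs a) ⊗ gmor g ⊗ idm (obs b) in lH *.
have -> : idm (obs p ⊠ obs a) ⊗ gmor g ⊗ idm (obs b ⊠ obs q) =
    idm (obs p) ⊗ F ⊗ idm (obs q) by rewrite -!tens_idm !tensA.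
rewrite (tens_comp_hom (hom_tens (I _) lH) (hom_tens (I _) wH) (I _) (I _)).
by rewrite (tens_comp_hom (I _) (I _) lH wH) !(comp_idmL (I _)).
Qed.

Definition computes s w t f := [/\ typed s w, out s w = t & wden s w = f].

Lemma computes_cat s v w t u f g : computes s v t f -> computes t w u g ->
  computes s (v ++ w) u (g ∘ f).
Proof.
move=> [tv ov dv] [tw ow dw]; have tvw : typed s (v ++ w).
  by rewrite typed_cat tv ov tw.
by split=> //; rewrite ?out_cat ?wden_wcat // ov ?dw ?dv.
Qed.

Lemma computes_shift p q s w t f : computes s w t f ->
  computes (p ++ s ++ q) (shift (size p) w) (p ++ t ++ q)
    (idm (obs p) ⊗ f ⊗ idm (obs q)).
Proof. by case=> tw <- <-; exact: shift_sound. Qed.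

Lemma computes_shiftr p s w t f : computes s w t f ->
  computes (p ++ s) (shift (size p) w) (p ++ t) (idm (obs p) ⊗ f).
Proof. by move/(computes_shift p [::]); rewrite !cats0 tens1r. Qed.

Lemma computes_shiftl q s w t f : computes s w t f ->
  computes (s ++ q) w (t ++ q) (f ⊗ idm (obs q)).
Proof.
move/(computes_shift [::] q); rewrite /= tens1l /shift.
by rewrite (eq_map (g := id)) ?map_id // => -[].
Qed.

Lemma computes_gen g : computes (gdom g) [:: (0, g)] (gcod g) (gmor g).
Proof.
have := fits_cat [::] [::] g; have := step_cat [::] [::] g.
have := lden_cat [::] [::] g; rewrite /= !cats0 tens1l tens1r => lE sE fE.
split=> /=; rewrite ?fE ?sE ?lE //.
exact: comp_idmL (gmor_hom g).
Qed.

Lemma computes_cross1 i t :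
  computes (i :: t) (cross1 i t) (t ++ [:: i]) (braid (wire_ob i) (obs t)).
Proof.
elim: t => [|j t IHt]; first by split=> //=; rewrite braid_unitr.
have := computes_cat (computes_shiftl t (computes_gen (Cross i j)))
  (computes_shiftr [:: j] IHt).
by rewrite (obs_cat [:: j] t) braid_tensr.
Qed.

Lemma computes_cross s t :
  computes (s ++ t) (cross s t) (t ++ s) (braid (obs s) (obs t)).
Proof.
elim: s => [|i s IHs]; first by split; rewrite ?cats0 //= braid_unitl.
have := computes_cat (computes_shiftr [:: i] IHs)
  (computes_shiftl s (computes_cross1 i t)).
by rewrite -catA (obs_cat [:: i] s) braid_tensl.
Qed.

Lemma compile_sound e : wf e ->
  computes (edom e) (compile e) (ecod e) (den e).
Proof.
elim: e => [s|g|s t|g IHg f IHf|f IHf g IHg] /=.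
- by [].
- by move=> _; exact: computes_gen.
- by move=> _; exact: computes_cross.
- case/and3P=> /IHg cg /IHf cf /eqP e.
  by apply: computes_cat cf _; rewrite e.
case/andP=> /IHf cf /IHg cg.
have := computes_cat (computes_shiftl (edom g) cf) (computes_shiftr (ecod f) cg).
suff -> : (idm (obs (ecod f)) ⊗ den g) ∘ (den f ⊗ idm (obs (edom g))) =
  den f ⊗ den g by [].
case: cf cg => [tf of' df] [tg og dg].
have := wden_hom tf; have := wden_hom tg; rewrite of' df og dg => gH fH.
exact: tens_top fH gH.
Qed.

(** Vacuous when [v] is ill-typed, and the typing of [w] is part of the conclusion; rewriting steps
    can therefore be stated without typing hypotheses. *)
Definition refines s v w :=
  forall t f, computes s v t f -> computes s w t f.

Lemma computes_catP s v w t f : computes s (v ++ w) t f ->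
  exists u g h, [/\ computes s v u g, computes u w t h & f = h ∘ g].
Proof.
case=> tvw; move: (tvw); rewrite typed_cat => /andP[tv tw] o d.
exists (out s v), (wden s v), (wden (out s v) w).
by split; [split|split; rewrite // -out_cat|rewrite -d wden_wcat].
Qed.

Lemma refines_cat s v v' w w' : refines s v v' -> refines (out s v) w w' ->
  refines s (v ++ w) (v' ++ w').
Proof.
move=> rv rw t f /computes_catP[u [g [h [cv cw ->]]]].
apply: computes_cat (rv _ _ cv) _.
by case: cv => _ e _; rewrite -e in cw *; exact: rw.
Qed.

Lemma computes_layer p q g :
  computes (p ++ gdom g ++ q) [:: (size p, g)] (p ++ gcod g ++ q)
    (idm (obs p) ⊗ gmor g ⊗ idm (obs q)).
Proof.
have := computes_shift p q (computes_gen g).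
by rewrite /shift /= addn0.
Qed.

(** Functoriality of [⊗], in the forms [tens_top] and [tens_bot], reduces both orders to one
    parallel tensor product. *)
Lemma computes_interchange p g q g' r :
  let s := p ++ gdom g ++ q ++ gdom g' ++ r in
  let t := p ++ gcod g ++ q ++ gcod g' ++ r in
  let f := idm (obs p) ⊗ gmor g ⊗ idm (obs q) ⊗ gmor g' ⊗ idm (obs r) in
  computes s [:: (size p, g); (size (p ++ gcod g ++ q), g')] t f /\
  computes s [:: (size (p ++ gdom g ++ q), g'); (size p, g)] t f.
Proof.
move=> s t f.
have pH := hom_tens (hom_idm (obs p)) (gmor_hom g).
have qH := hom_tens (hom_idm (obs q)) (hom_tens (gmor_hom g') (hom_idm (obs r))).
have eF : f = idm (obs p) ⊗ gmor g ⊗ (idm (obs q) ⊗ (gmor g' ⊗ idm (obs r))).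
  by rewrite /f !tensA.
have eI u v w : idm (obs u) ⊗ gmor g ⊗ idm (obs (q ++ v ++ w)) =
    idm (obs u) ⊗ gmor g ⊗ idm (obs q ⊠ (obs v ⊠ obs w)).
  by rewrite !obs_cat.
have eI' u v : idm (obs (p ++ u ++ q)) ⊗ gmor g' ⊗ idm (obs v) =
    idm (obs p ⊠ obs u) ⊗ (idm (obs q) ⊗ (gmor g' ⊗ idm (obs v))).
  by rewrite !obs_cat !tens_obA -tens_idm !tensA.
split.
- have := computes_cat (computes_layer p (q ++ gdom g' ++ r) g).
  move: (computes_layer (p ++ gcod g ++ q) r g'); rewrite -!catA => H /(_ _ _ _ H).
  by rewrite eI eI' (tens_top pH qH) -eF.
have := computes_cat (computes_layer (p ++ gdom g ++ q) r g').
move: (computes_layer p (q ++ gcod g' ++ r) g); rewrite -!catA => H /(_ _ _ _ H).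
by rewrite eI eI' (tens_bot pH qH) -eF.
Qed.

Lemma swap_sound s l l' k k' : swap l l' = Some (k', k) ->
  refines s [:: l; l'] [:: k'; k].
Proof.
move=> sw t f cll.
(* A word has only one denotation from a given source, so it is enough that both orders compute some
   common [h]. *)
suff [h [c1 c2]] : exists h, computes s [:: l; l'] (out s [:: l; l']) h /\
    computes s [:: k'; k] (out s [:: l; l']) h.
  by case: cll c1 => [_ <- <-] [_ _ ->].
case: cll => + _ _; move: sw; case: l l' => [o g] [o' g'] /= /[swap].
case/and3P=> /fitsP[p [q /= [-> ->]]]; rewrite step_cat.
case/fitsP=> p' [q' /= [e ->]]; rewrite e step_cat => _.
case: leqP => [le_p|_].
  move=> [<- <-].
  have [r [-> eq']] : exists r, p = (p' ++ gdom g') ++ r /\ q' = r ++ gcod g ++ q.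
    by apply: cat_prefix; rewrite ?size_cat // e catA.
  have [H1 H2] := computes_interchange p' g' r g q.
  exists (idm (obs p') ⊗ gmor g' ⊗ idm (obs r) ⊗ gmor g ⊗ idm (obs q)).
  rewrite eq' -!catA; split=> //; move: H1; congr (computes _ [:: _; (_, _)] _ _).
  by rewrite !size_cat [in RHS]addnCA addKn addnA addnAC.
case: leqP => // le_p [<- <-].
have [r [-> eq]] : exists r, p' = (p ++ gcod g) ++ r /\ q = r ++ gdom g' ++ q'.
  by apply: cat_prefix; rewrite ?size_cat // -e catA.
have [H1 H2] := computes_interchange p g r g' q'.
exists (idm (obs p) ⊗ gmor g ⊗ idm (obs r) ⊗ gmor g' ⊗ idm (obs q')).
rewrite eq -!catA; split=> //; move: H2; congr (computes _ [:: (_, _); _] _ _).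
by rewrite !size_cat [in RHS]addnCA addKn addnA addnAC.
Qed.

Lemma refines_refl s w : refines s w w. Proof. by []. Qed.

Lemma refines_trans s u v w : refines s u v -> refines s v w -> refines s u w.
Proof. by move=> uv vw t f /uv/vw. Qed.

Lemma refines_catl u s v w : refines (out s u) v w ->
  refines s (u ++ v) (u ++ w).
Proof. exact: refines_cat (@refines_refl s u). Qed.

Lemma refines_catr u s v w : refines s v w -> refines s (v ++ u) (w ++ u).
Proof. by move/refines_cat; apply. Qed.

Lemma slide_sound s w x y v : slide w x = Some (y, v) ->
  refines s (rcons w x) (y :: v).
Proof.
elim: w s x y v => [|z w IHw] s x y v /=; first by move=> [-> ->].
case E: (slide w x) => [[x1 w1]|] //; case E': (swap z x1) => [[x2 z2]|] //.
move=> [<- <-]; apply: (@refines_trans _ _ [:: z, x1 & w1]).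
  exact: (@refines_catl [:: z]) (IHw _ _ _ _ E).
exact: (@refines_catr w1) (swap_sound (s := s) E').
Qed.

Lemma gather_sound p s pre blk aft rest pre' blk' post :
  gather p pre blk aft rest = Some (pre', blk', post) ->
  refines s (pre ++ blk ++ aft ++ rest) (pre' ++ blk' ++ post).
Proof.
elim: rest pre blk aft => [|x rest IH] pre blk aft /=.
  by case: eqP => // _ [<- <- <-].
case: eqP => [_ [<- <- <-] //|_].
(* Covers the two branches in which [x] is postponed to [aft]. *)
have stay : gather p pre blk (rcons aft x) rest = Some (pre', blk', post) ->
    refines s (pre ++ blk ++ aft ++ x :: rest) (pre' ++ blk' ++ post).
  by move/IH; rewrite cat_rcons.
case E: (slide aft x) => [[x1 aft1]|] //.
have R1 : refines s (pre ++ blk ++ aft ++ x :: rest)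
    (pre ++ blk ++ x1 :: aft1 ++ rest).
  do 2!apply: refines_catl; rewrite -cat_rcons -cat_cons.
  exact/refines_catr/slide_sound.
case: eqP => [_ /IH|_]; first by rewrite cat_rcons; exact: refines_trans.
case E': (slide blk x1) => [[x2 blk2]|] // /IH; rewrite cat_rcons.
apply: refines_trans; apply: refines_trans R1 _.
apply: refines_catl; rewrite -cat_rcons -[x2 :: _]/((x2 :: blk2) ++ _).
exact/refines_catr/slide_sound.
Qed.

Definition wsound (r : wrule) := exists t f,
  computes (wdom r) (wlhs r) t f /\ computes (wdom r) (wrhs r) t f.

Lemma wsound_shift r p q : wsound r ->
  refines (p ++ wdom r ++ q) (shift (size p) (wlhs r)) (shift (size p) (wrhs r)).
Proof.
case=> u [g [/(computes_shift p q) [_ ol dl] /(computes_shift p q) cr]] t f.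
by case=> _; rewrite ol dl => <- <-.
Qed.

Lemma rewrite_at_sound r s w i w' : wsound r -> rewrite_at r s w i = Some w' ->
  refines s w w'.
Proof.
move=> sr; rewrite /rewrite_at.
case Ew: (drop i w) => [|x rest] //; case Er: (wlhs r) => [|y l] //.
rewrite -{}Er; case: eqP => // _.
case G: (gather _ _ _ _ _) => [[[pre blk] post]|] //.
case: ifP => // /and3P[/eqP eb le_n /eqP ed] [<-].
have := gather_sound (s := s) G; rewrite /= -Ew cat_take_drop.
move/refines_trans; apply; apply: refines_catl; apply: refines_catr.
rewrite {1}eb; set n := offset _ _ in le_n ed *.
have [a [q [-> ->]]] : exists a q, out s pre = a ++ wdom r ++ q /\ n = size a.
  exists (take n (out s pre)), (drop (size (wdom r)) (drop n (out s pre))).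
  by rewrite -{1}ed !cat_take_drop size_takel.
exact: wsound_shift.
Qed.

Lemma replay_sound rs s tr w : (forall r, List.In r rs -> wsound r) ->
  refines s w (replay rs s tr w).
Proof.
move=> srs; elim: tr w => [|[k i] tr IH] w //=.
case E: (drop k rs) => [|r l] //; case E': (rewrite_at r s w i) => [w'|] //.
apply: refines_trans (IH w'); apply: rewrite_at_sound E'; apply: srs.
rewrite -(cat_take_drop k rs) E; apply/List.in_app_iff; right; exact: List.in_eq.
Qed.

Lemma pull_sound s x k aft rest : pull x k aft rest ->
  exists v, k v /\ refines s (aft ++ rest) (x :: v).
Proof.
elim: rest aft => //= y rest IH aft.
case: ifP => [|_ /IH]; last by rewrite cat_rcons.
case E: (slide aft y) => [[y1 aft1]|] //; case: eqP => // <- kv _.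
exists (aft1 ++ rest); split=> //.
by rewrite -cat_rcons -cat_cons; exact/refines_catr/slide_sound.
Qed.

Lemma same_sound s v w : same v w -> refines s v w.
Proof.
elim: w s v => [|x w IH] s v /=; first by move/nilP->.
case/(pull_sound s) => v' [/IH H R].
by apply: refines_trans R _; exact: (@refines_catl [:: x]).
Qed.

Fixpoint valid (rs : seq rule) : Prop :=
  if rs is r :: rs' then den r.1 = den r.2 /\ valid rs' else True.

Lemma valid_cat rs rs' : valid rs -> valid rs' -> valid (rs ++ rs').
Proof. by elim: rs => //= r rs IH [? /IH] H /H. Qed.

Lemma compile_rule_sound rs r : valid rs -> all rule_wf rs ->
  List.In r (map compile_rule rs) -> wsound r.
Proof.
elim: rs => //= -[e e'] rs IH [/= eE vrs] /andP[/and4P[/= we we' /eqP ed /eqP ec]].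
move=> wrs [<-|]; last exact: IH.
exists (ecod e), (den e); split; first exact: compile_sound.
by rewrite eE ec /= ed; exact: compile_sound.
Qed.

Theorem check_sound rs e e' tr tr' : valid rs -> check rs e e' tr tr' ->
  den e = den e'.
Proof.
move=> vrs /and3P[wrs /and4P[/= we we' /eqP ed /eqP ec] sm].
have srs r := @compile_rule_sound rs r vrs wrs.
(* Each normalized word still computes the denotation of its own expression. The first refines to
   the second, which has a single denotation. *)
have [_ _ <-] := same_sound sm (replay_sound tr srs (compile_sound we)).
have := replay_sound tr' srs (compile_sound we'); rewrite -ed.
by case.
Qed.

End Semantics.

(** * Reification of morphism terms *)

Ltac reify_ob X :=
  lazymatch X with
  | unit_ob _ => constr:(@nil wire)
  | B1 _ => constr:([:: true])
  | B2 _ => constr:([:: false])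
  | ?X ⊠ ?Y =>
    let s := reify_ob X in let t := reify_ob Y in eval cbv in (s ++ t)
  end.

Ltac reify f :=
  lazymatch f with
  | idm ?X => let s := reify_ob X in constr:(Id s)
  | braid ?X ?Y =>
    let s := reify_ob X in let t := reify_ob Y in constr:(Braid s t)
  | ?g ∘ ?f => let d := reify g in let e := reify f in constr:(Comp d e)
  | ?f ⊗ ?g => let d := reify f in let e := reify g in constr:(Tens d e)
  | m1 _ => constr:(Gen (Mul true))
  | m2 _ => constr:(Gen (Mul false))
  | eta1 _ => constr:(Gen (Unit true))
  | eta2 _ => constr:(Gen (Unit false))
  | Delta1 _ => constr:(Gen (Comul true))
  | Delta2 _ => constr:(Gen (Comul false))
  | eps1 _ => constr:(Gen (Counit true))
  | eps2 _ => constr:(Gen (Counit false))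
  | mu_l _ => constr:(Gen ActL)
  | mu_r _ => constr:(Gen ActR)
  | nu_l _ => constr:(Gen CoactL)
  | nu_r _ => constr:(Gen CoactR)
  end.

Ltac unfold_all T :=
  eval cbv beta iota delta [mB DeltaB etaB epsB phi12 phi21 Phi PhiL PhiR PhiL'
    PhiR' PhiP PhiQ pi_unit] in T.

Ltac reify_rules P :=
  lazymatch P with
  | True => constr:(@nil rule)
  | ?f = ?g /\ ?P' =>
    let d := reify f in let e := reify g in
    let rs := reify_rules P' in constr:((d, e) :: rs)
  end.

Ltac reify_axioms ax :=
  let P := type of ax in let P := unfold_all P in
  let rs := reify_rules P in exact rs.

(** * The axioms of a Hopf datum as rewriting rules *)

Section Rules.
Context {C : strict_braided} {D : hopf_predatum C} (HD : is_hopf_datum D).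

Let comul_unit A Delta eps eta
  (H : @unit_is_coalgebra_morphism C A Delta eps eta) :
  Delta ∘ eta = (eta ⊗ eta) ∘ idm (unit_ob C).
Proof. by case: H. Qed.

Let counit_mul A m eta eps (H : @counit_is_algebra_morphism C A m eta eps) :
  eps ∘ m = idm (unit_ob C) ∘ (eps ⊗ eps).
Proof. by case: H. Qed.

Let counit_unit A m eta eps (H : @counit_is_algebra_morphism C A m eta eps) :
  eps ∘ eta = idm (unit_ob C).
Proof. by case: H. Qed.

Local Notation "p ;; q" := (conj p q) (at level 85, right associativity).

Definition unit_axioms :=
  alg_unitl (hd_alg1 HD) ;; alg_unitr (hd_alg1 HD) ;;
  coalg_counitl (hd_coalg1 HD) ;; coalg_counitr (hd_coalg1 HD) ;;
  counit_mul (hd_counit1 HD) ;; comul_unit (hd_unit1 HD) ;;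
  counit_unit (hd_counit1 HD) ;;
  alg_unitl (hd_alg2 HD) ;; alg_unitr (hd_alg2 HD) ;;
  coalg_counitl (hd_coalg2 HD) ;; coalg_counitr (hd_coalg2 HD) ;;
  counit_mul (hd_counit2 HD) ;; comul_unit (hd_unit2 HD) ;;
  counit_unit (hd_counit2 HD) ;;
  lmod_unit (hd_lmod HD) ;; rmod_unit (hd_rmod HD) ;;
  lcomod_counit (hd_lcomod HD) ;; rcomod_counit (hd_rcomod HD) ;;
  hd_mur_unit HD ;; hd_nul_counit HD ;; hd_mur_counit HD ;; hd_mul_counit HD ;;
  hd_mul_unit HD ;; hd_nur_counit HD ;; hd_nur_unit HD ;; hd_nul_unit HD ;; I.

(** Kept apart from the other compatibilities because the expansion in [Phi_comul_mul] uses these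
    two rules alone. *)
Definition alg_coalg_axioms := hd_alg_coalg1 HD ;; hd_alg_coalg2 HD ;; I.

(** The two equations reversed by [esym] make the rules for right actions agree with those for left
    ones: acting by a product becomes acting twice, and dually for coactions. *)
Definition compat_axioms :=
  hd_mod_coalgr HD ;; hd_mod_coalgl HD ;; hd_comod_algr HD ;; hd_comod_algl HD ;;
  alg_assoc (hd_alg1 HD) ;; alg_assoc (hd_alg2 HD) ;;
  coalg_coassoc (hd_coalg1 HD) ;; coalg_coassoc (hd_coalg2 HD) ;;
  lmod_assoc (hd_lmod HD) ;; esym (rmod_assoc (hd_rmod HD)) ;;
  lcomod_coassoc (hd_lcomod HD) ;; esym (rcomod_coassoc (hd_rcomod HD)) ;; I.

Definition mod_alg_axioms := hd_mod_algr HD ;; hd_mod_algl HD ;; I.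

Definition comod_coalg_axioms := hd_comod_coalgr HD ;; hd_comod_coalgl HD ;; I.

Definition unit_rules : seq rule := ltac:(reify_axioms unit_axioms).
Definition alg_coalg_rules : seq rule := ltac:(reify_axioms alg_coalg_axioms).
Definition compat_rules : seq rule := ltac:(reify_axioms compat_axioms).
Definition mod_alg_rules : seq rule := ltac:(reify_axioms mod_alg_axioms).
Definition comod_coalg_rules : seq rule :=
  ltac:(reify_axioms comod_coalg_axioms).

Definition over (g : gen) (i : wire) : rule :=
  (Comp (Braid (gcod g) [:: i]) (Tens (Gen g) (Id [:: i])),
   Comp (Tens (Id [:: i]) (Gen g)) (Braid (gdom g) [:: i])).

Definition under (g : gen) (i : wire) : rule :=
  (Comp (Braid [:: i] (gcod g)) (Tens (Id [:: i]) (Gen g)),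
   Comp (Tens (Gen g) (Id [:: i])) (Braid [:: i] (gdom g))).

Definition flip (r : rule) : rule := (r.2, r.1).

(* Braidings are moved before products and actions, and after coproducts and
   coactions. *)
Definition nat_rules : seq rule :=
  [seq over g i | g <- [:: Mul true; Mul false; ActL; ActR; Unit true;
     Unit false], i <- [:: true; false]] ++
  [seq under g i | g <- [:: Mul true; Mul false; ActL; ActR; Unit true;
     Unit false], i <- [:: true; false]] ++
  [seq flip (over g i) | g <- [:: Comul true; Comul false; CoactL; CoactR;
     Counit true; Counit false], i <- [:: true; false]] ++
  [seq flip (under g i) | g <- [:: Comul true; Comul false; CoactL; CoactR;
     Counit true; Counit false], i <- [:: true; false]] ++
  [seq over (Cross p.1 p.2) i | p <- [:: (true, true); (true, false);
     (false, true); (false, false)], i <- [:: true; false]].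

(** Naturality of the braiding; when [g] is a crossing this is the Yang-Baxter equation. *)
Lemma over_valid g i : den D (over g i).1 = den D (over g i).2.
Proof.
have [sg tg] := gmor_hom HD g; have [si ti] := hom_idm (obs D [:: i]).
have := braid_nat (gmor D g) (idm (obs D [:: i])).
by rewrite sg tg si ti.
Qed.

Lemma under_valid g i : den D (under g i).1 = den D (under g i).2.
Proof.
have [sg tg] := gmor_hom HD g; have [si ti] := hom_idm (obs D [:: i]).
have := braid_nat (idm (obs D [:: i])) (gmor D g).
by rewrite sg tg si ti.
Qed.

Lemma valid_allpairs (S T : Type) (r : S -> T -> rule) s t :
  (forall x y, den D (r x y).1 = den D (r x y).2) ->
  valid D [seq r x y | x <- s, y <- t].
Proof.
move=> vr; elim: s => //= x s IHs; apply: valid_cat IHs.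
by elim: t => //= y t IHt; split.
Qed.

Lemma nat_valid : valid D nat_rules.
Proof.
apply: valid_cat; last apply: valid_cat; last apply: valid_cat;
  last apply: valid_cat; apply: valid_allpairs => g i.
- exact: over_valid.
- exact: under_valid.
- by rewrite /= -[LHS]/(den D (over g i).2) -over_valid.
- by rewrite /= -[LHS]/(den D (under g i).2) -under_valid.
exact: over_valid.
Qed.

Definition basic_rules := nat_rules ++ unit_rules.

(* The module-algebra and comodule-coalgebra rules together would loop. *)
Definition algebra_rules :=
  basic_rules ++ alg_coalg_rules ++ compat_rules ++ mod_alg_rules.

Definition coalgebra_rules :=
  basic_rules ++ alg_coalg_rules ++ compat_rules ++ comod_coalg_rules.

Lemma basic_valid : valid D basic_rules.
Proof. exact: valid_cat nat_valid (unit_axioms : valid D unit_rules). Qed.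

Lemma compat_valid : valid D (alg_coalg_rules ++ compat_rules).
Proof.
exact: valid_cat (alg_coalg_axioms : valid D alg_coalg_rules)
  (compat_axioms : valid D compat_rules).
Qed.

Lemma algebra_valid : valid D algebra_rules.
Proof.
apply: valid_cat basic_valid _; rewrite catA.
exact: valid_cat compat_valid (mod_alg_axioms : valid D mod_alg_rules).
Qed.

Lemma coalgebra_valid : valid D coalgebra_rules.
Proof.
apply: valid_cat basic_valid _; rewrite catA.
exact: valid_cat compat_valid (comod_coalg_axioms : valid D comod_coalg_rules).
Qed.

End Rules.

(** The number 500 bounds the length of a trace. *)
Ltac diagram HD V :=
  lazymatch type of V with valid ?D ?rs =>
  lazymatch goal with |- ?f = ?g =>
    let f := unfold_all f in let e := reify f in
    let g := unfold_all g in let e' := reify g in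
    let tr := eval vm_compute in
      (search 500 (map compile_rule rs) (edom e) (compile e)) in
    let tr' := eval vm_compute in
      (search 500 (map compile_rule rs) (edom e') (compile e')) in
    apply: (@check_sound _ D HD rs e e' tr tr' V);
    vm_compute; reflexivity
  end end.

(** * The cross product bialgebra *)

Section CrossProduct.
Context {C : strict_braided} {D : hopf_predatum C} (HD : is_hopf_datum D).

Local Notation B1 := (B1 D).
Local Notation B2 := (B2 D).
Local Notation B := (B1 ⊠ B2).
Local Notation id1 := (idm B1).
Local Notation id2 := (idm B2).
Local Notation Psi11 := (braid B1 B1).
Local Notation Psi22 := (braid B2 B2).

Local Notation comul_mul := (DeltaB D ∘ mB D).
Local Notation mul_comul :=
  ((mB D ⊗ mB D) ∘ (idm B ⊗ braid B B ⊗ idm B) ∘ (DeltaB D ⊗ DeltaB D)).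
Local Notation unit_in := (eta1 D ⊗ id2 ⊗ id1 ⊗ eta2 D).
Local Notation counit_out := (eps1 D ⊗ id2 ⊗ id1 ⊗ eps2 D).

Lemma mB_algebra : is_algebra B (mB D) (etaB D).
Proof.
split; [exact: mB_hom | exact: etaB_hom | | |].
- diagram HD (algebra_valid HD).
- diagram HD (algebra_valid HD).
diagram HD (algebra_valid HD).
Qed.

Lemma DeltaB_coalgebra : is_coalgebra B (DeltaB D) (epsB D).
Proof.
split; [exact: DeltaB_hom | exact: epsB_hom | | |].
- diagram HD (coalgebra_valid HD).
- diagram HD (algebra_valid HD).
diagram HD (algebra_valid HD).
Qed.

(** The module-coalgebra axioms push the coproducts through the two actions; the products and inner
    actions that they create assemble to [mB]. *)
Lemma comul_phi21 :
  (Delta1 D ⊗ Delta2 D) ∘ phi21 D = (id1 ⊗ mB D ⊗ id2) ∘ PhiP D.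
Proof. diagram HD (algebra_valid HD). Qed.

(** Dual to [comul_phi21], through the comodule-algebra axioms. *)
Lemma phi12_mul :
  phi12 D ∘ (m1 D ⊗ m2 D) = PhiQ D ∘ (id1 ⊗ DeltaB D ⊗ id2).
Proof. diagram HD (algebra_valid HD). Qed.

Lemma Phi_comul_mul : Phi D comul_mul = comul_mul.
Proof.
(* The algebra-coalgebra axioms, applied to the middle [Delta1 ∘ m1] and [Delta2 ∘ m2], split off
   the outer factors of [Phi]. *)
have {2}-> : comul_mul =
  (PhiL' D ⊗ (phi12 D ∘ (m1 D ⊗ m2 D)) ⊗ PhiR' D)
  ∘ (id1 ⊗ id2 ⊗ Psi11 ⊗ id1 ⊗ id2 ⊗ Psi22 ⊗ id1 ⊗ id2)
  ∘ (PhiL D ⊗ ((Delta1 D ⊗ Delta2 D) ∘ phi21 D) ⊗ PhiR D).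
  diagram HD (alg_coalg_axioms HD : valid D alg_coalg_rules).
(* The empty rule list leaves only interchange: [DeltaB] and [mB] meet in the middle of [PhiQ] and
   [PhiP]. *)
rewrite comul_phi21 phi12_mul; diagram HD (I : valid D [::]).
Qed.

Lemma comul_mul_comul :
  (Delta1 D ⊗ id2 ⊗ id1 ⊗ Delta2 D) ∘ (mul_comul ∘ unit_in) =
  (id1 ⊗ mul_comul ⊗ id2) ∘ PhiP D.
Proof. diagram HD (coalgebra_valid HD). Qed.

Lemma Phi_mul_comul : Phi D mul_comul = mul_comul.
Proof.
(* This recovers [mul_comul] from its restriction along [unit_in]; [comul_mul_comul] then trades the
   restriction for [mul_comul] itself, preceded by [PhiP]. *)
have {2}-> : mul_comul =
  (PhiL' D ⊗ PhiQ D ⊗ PhiR' D)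
  ∘ (id1 ⊗ id2 ⊗ Psi11 ⊗ id1 ⊗ id2 ⊗ id1 ⊗ id2 ⊗ Psi22 ⊗ id1 ⊗ id2)
  ∘ (PhiL D ⊗ ((Delta1 D ⊗ id2 ⊗ id1 ⊗ Delta2 D) ∘ (mul_comul ∘ unit_in))
     ⊗ PhiR D).
  diagram HD (algebra_valid HD).
rewrite comul_mul_comul. diagram HD (I : valid D [::]).
Qed.

Lemma pi_comul_mul :
  pi_unit D ∘ comul_mul ∘ pi_unit D = pi_unit D ∘ mul_comul ∘ pi_unit D.
Proof.
(* Since [pi_unit] is [unit_in ∘ counit_out], only [counit_out ∘ comul_mul ∘ unit_in] matters, and
   the unit and counit axioms reduce it to [phi12 ∘ phi21]. *)
transitivity (unit_in ∘ (phi12 D ∘ phi21 D) ∘ counit_out).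
  diagram HD (basic_valid HD).
rewrite (hd_mod_comod HD); diagram HD (algebra_valid HD).
Qed.

Lemma recursive_fixpoints f f' : recursive D ->
  f ::: B1 ⊠ B2 ⊠ B1 ⊠ B2 ~> B1 ⊠ B2 ⊠ B1 ⊠ B2 ->
  f' ::: B1 ⊠ B2 ⊠ B1 ⊠ B2 ~> B1 ⊠ B2 ⊠ B1 ⊠ B2 ->
  Phi D f = f -> Phi D f' = f' ->
  pi_unit D ∘ f ∘ pi_unit D = pi_unit D ∘ f' ∘ pi_unit D -> f = f'.
Proof.
move=> rec fH fH' fix_f fix_f' e.
have [n En] := rec f fH; have [n' En'] := rec f' fH'.
rewrite iter_fix // e in En; rewrite iter_fix // in En'.
(* The exponents for [f] and [f'] may differ, so both fixed points are compared after [n + n']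
   iterations from [pi_unit ∘ f' ∘ pi_unit]. *)
rewrite -(iter_fix n' fix_f) En -iterD addnC iterD -En'.
exact: iter_fix.
Qed.

End CrossProduct.

Theorem theorem2p14 (C : strict_braided) (hsplit : idempotents_split C)
    (D : hopf_predatum C) (HD : is_hopf_datum D) (Hrec : recursive D) :
  is_bialgebra (tens_ob (B1 D) (B2 D)) (mB D) (etaB D) (DeltaB D) (epsB D).
Proof.
have mH := mB_hom HD; have DH := DeltaB_hom HD.
have eH := etaB_hom HD; have cH := epsB_hom HD.
split; [exact: mB_algebra | exact: DeltaB_coalgebra | | |].
- apply: (recursive_fixpoints Hrec).
  + by hom_tac.
  + by hom_tac.
  + exact: Phi_comul_mul.
  + exact: Phi_mul_comul.
  exact: pi_comul_mul.
- split=> //; diagram HD (basic_valid HD).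
split=> //; diagram HD (basic_valid HD).
Qed.
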